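(* Let $d\ge4$ be an even integer and, for $(p,q)\in\mathbb{R}^2$, let $$\mathcal{L}_{p,q}:M_d(\mathbb{C})\to M_d(\mathbb{C}),\qquad Z\mapsto(1-p-q)\frac{\operatorname{Tr}(Z)}{d}I_d+pZ+q\,\Omega_dZ^\top\Omega_d^*.$$ Then $\mathcal{L}_{p,q}$ is positive if and only if $(p,q)\in\mathbb{P}_1$, and $\mathcal{L}_{p,q}$ is decomposable if and only if $(p,q)\in\mathbb{D}$, where $$\mathbb{P}_1=\{(p,q)\in\mathbb{R}^2:\ p+q\le1,\ \ p+(1-d)q\le1,\ \ (1-d)p+q\le1\},$$ $$\mathbb{D}=\Big\{(p,q)\in\mathbb{R}^2:\ -\tfrac{2+d}{d^2-d-2}\le p+q\le1,\ \ p+(1-d)q\le1,\ \ (1-d)p+q\le1\Big\}.$$ In particular, $\mathcal{L}_{p,q}$ is positive and indecomposable in the parameter region $p+q<-\frac{2+d}{d^2-d-2}$, $p+(1-d)q\le1$, $(1-d)p+q\le1$.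
   Context: $\Omega_d=\begin{pmatrix}0&I_{d/2}\\-I_{d/2}&0\end{pmatrix}$. A linear map $\mathcal{L}$ on $M_d(\mathbb{C})$ is positive if it maps positive semidefinite matrices to positive semidefinite matrices; completely positive (CP) if $\mathrm{id}_k\otimes\mathcal{L}$ is positive for all $k\ge1$; completely copositive (co-CP) if $\top\circ\mathcal{L}$ is CP, where $\top(Z)=Z^\top$; decomposable if it is the sum of a CP and a co-CP map, and indecomposable otherwise. *)

(* Defs.v *)
From HB Require Import structures.
From mathcomp Require Import all_boot all_order all_algebra.
From mathcomp Require Import spectral ring.
From mathcomp Require Import complex mxtens.
From mathcomp Require Import reals.

Set Implicit Arguments.
Unset Strict Implicit.
Unset Printing Implicit Defensive.

Import Order.TTheory GRing.Theory Num.Theory.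

Local Open Scope ring_scope.
Local Open Scope sesquilinear_scope.
Local Open Scope complex_scope.

(* For C : numClosedFieldType, [0 <= z] implies that z is real. *)
Definition psdmx (C : numClosedFieldType) (n : nat) (A : 'M[C]_n) : Prop :=
  A \is hermsymmx /\ forall v : 'cV[C]_n, 0 <= (v^t* *m A *m v) 0 0.

Definition positive_map (C : numClosedFieldType) (m n : nat)
    (L : {linear 'M[C]_m -> 'M[C]_n}) : Prop :=
  forall Z : 'M[C]_m, psdmx Z -> psdmx (L Z).

(* The (i, j) block of X, where 'M_(k * m) is identified with 'M_k (x) 'M_m
   as in tensmx. *)
Definition tensblock (R : pzRingType) (k m : nat) (X : 'M[R]_(k * m))
    (i j : 'I_k) : 'M[R]_m :=
  \matrix_(a, b) X (mxtens_index (i, a)) (mxtens_index (j, b)).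

(* id_k (x) L, which applies L to each block; see [id_tens_tensmx]. *)
Definition id_tens (C : comNzRingType) (k m n : nat)
    (L : {linear 'M[C]_m -> 'M[C]_n}) (X : 'M[C]_(k * m)) : 'M[C]_(k * n) :=
  \sum_(i < k) \sum_(j < k) delta_mx i j *t L (tensblock X i j).

Lemma id_tensE (C : comNzRingType) (k m n : nat)
    (L : {linear 'M[C]_m -> 'M[C]_n}) (X : 'M[C]_(k * m)) i j a b :
  id_tens L X (mxtens_index (i, a)) (mxtens_index (j, b)) =
  L (tensblock X i j) a b.
Proof.
rewrite /id_tens summxE (bigD1 i) //= summxE (bigD1 j) //=.
rewrite !tensmxE mxE !eqxx mul1r !big1 ?addr0 // => [i' /negPf ne|j' /negPf ne].
  by rewrite summxE big1 // => j' _; rewrite tensmxE mxE eq_sym ne mul0r.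
by rewrite tensmxE mxE eqxx eq_sym ne mul0r.
Qed.

Fact id_tens_is_linear (C : comNzRingType) (k m n : nat)
    (L : {linear 'M[C]_m -> 'M[C]_n}) : linear (@id_tens C k m n L).
Proof.
move=> c X Y; apply/matrixP => r s.
case: (mxtens_indexP r) => i a; case: (mxtens_indexP s) => j b.
rewrite !mxE !id_tensE.
have -> : tensblock (c *: X + Y) i j = c *: tensblock X i j + tensblock Y i j.
  by apply/matrixP => a' b'; rewrite !mxE.
by rewrite linearP !mxE.
Qed.

HB.instance Definition _ (C : comNzRingType) (k m n : nat)
    (L : {linear 'M[C]_m -> 'M[C]_n}) :=
  GRing.isLinear.Build C 'M[C]_(k * m) 'M[C]_(k * n) *:%R
    (@id_tens C k m n L) (id_tens_is_linear L).

Lemma id_tens_tensmx (C : comNzRingType) (k m n : nat)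
    (L : {linear 'M[C]_m -> 'M[C]_n}) (A : 'M[C]_k) (B : 'M[C]_m) :
  id_tens L (A *t B) = A *t L B.
Proof.
apply/matrixP => r s.
case: (mxtens_indexP r) => i a; case: (mxtens_indexP s) => j b.
rewrite id_tensE tensmxE.
have -> : tensblock (A *t B) i j = A i j *: B.
  by apply/matrixP => a' b'; rewrite mxE tensmxE mxE.
by rewrite linearZ mxE.
Qed.

Definition completely_positive (C : numClosedFieldType) (m n : nat)
    (L : {linear 'M[C]_m -> 'M[C]_n}) : Prop :=
  forall k : nat, (0 < k)%N -> positive_map (@id_tens C k m n L).

Definition completely_copositive (C : numClosedFieldType) (m n : nat)
    (L : {linear 'M[C]_m -> 'M[C]_n}) : Prop :=
  completely_positive (@trmx C n n \o L).

Definition decomposable (C : numClosedFieldType) (m n : nat)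
    (L : {linear 'M[C]_m -> 'M[C]_n}) : Prop :=
  exists L1 L2 : {linear 'M[C]_m -> 'M[C]_n},
    [/\ completely_positive L1, completely_copositive L2 &
        forall Z : 'M[C]_m, L Z = L1 Z + L2 Z].

Definition indecomposable (C : numClosedFieldType) (m n : nat)
    (L : {linear 'M[C]_m -> 'M[C]_n}) : Prop := ~ decomposable L.

(* Meaningful for d even; see [Omega_block]. *)
Definition Omega (C : pzRingType) (d : nat) : 'M[C]_d :=
  \matrix_(i, j) ((j == i + d./2 :> nat)%N%:R - (i == j + d./2 :> nat)%N%:R).

Lemma Omega_block (C : pzRingType) (m : nat) :
  Omega C (m + m) = block_mx 0 1%:M (- 1%:M) 0.
Proof.
have neq (i j : 'I_m) : (i == m + j + m :> nat)%N = false.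
  by apply/ltn_eqF; rewrite (leq_trans (ltn_ord i)) // leq_addl.
have half : (m + m)./2 = m by rewrite addnn doubleK.
apply/matrixP => i j; rewrite !mxE half.
case: splitP => i' ->; rewrite !mxE; case: splitP => j' ->; rewrite !mxE.
- by rewrite !ltn_eqF ?subr0 // ltn_addl.
- by rewrite neq subr0 addnC eqn_add2r eq_sym.
- by rewrite neq sub0r addnC eqn_add2r.
- by rewrite -!addnA !eqn_add2l !ltn_eqF ?subr0 // ltn_addl.
Qed.

Definition Lpq (R : realType) (d : nat) (p q : R) (Z : 'M[R[i]]_d) :
    'M[R[i]]_d :=
  ((1 - p - q)%:C * (\tr Z / d%:R)) *: 1%:M + p%:C *: Z
  + q%:C *: (Omega R[i] d *m Z^T *m (Omega R[i] d)^t*).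

Fact Lpq_is_linear (R : realType) (d : nat) (p q : R) :
  linear (@Lpq R d p q).
Proof.
move=> c X Y; rewrite /Lpq !linearP /=.
rewrite mulmxDl -scalemxAl.
apply/matrixP => i j; rewrite !mxE; ring.
Qed.

HB.instance Definition _ (R : realType) (d : nat) (p q : R) :=
  GRing.isLinear.Build R[i] 'M[R[i]]_d 'M[R[i]]_d *:%R
    (@Lpq R d p q) (Lpq_is_linear p q).

Definition P1 (R : realType) (d : nat) : {pred R * R} :=
  [pred x : R * R | let: (p, q) := x in
    [&& p + q <= 1, p + (1 - d%:R) * q <= 1 & (1 - d%:R) * p + q <= 1]].

Definition Dset (R : realType) (d : nat) : {pred R * R} :=
  [pred x : R * R | let: (p, q) := x in
    [&& - ((2 + d%:R) / (d%:R ^+ 2 - d%:R - 2)) <= p + q, p + q <= 1,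
        p + (1 - d%:R) * q <= 1 & (1 - d%:R) * p + q <= 1]].

(* Main.v *)
Require Import Defs.
From HB Require Import structures.
From mathcomp Require Import all_boot all_order all_algebra.
From mathcomp Require Import complex mxtens reals.
From mathcomp Require Import spectral ring lra.

(** Put [c = (1 - p - q) / d], so that the map is
    [Z |-> c Tr(Z) I + p Z + q T(Z)] with [T(Z) = Omega Z^T Omega^*].

    Positivity: for a vector [u], the vector [w = Omega conj(u)] is orthogonal
    to [u] and has the same norm, and [u^* L(Z) u] is
    [c (Tr(Z) |u|^2 - u^* Z u - w^* Z w) + (c + p) u^* Z u + (c + q) w^* Z w],
    whose first bracket is nonnegative.  So positivity means
    [c, c + p, c + q >= 0]; necessity is seen on the diagonal of [L(E_00)].

    Decomposability: the cone of these maps cut out by the extra inequality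
    [(d + 2) c + d (p + q) >= 0] is generated by the identity and
    [Z |-> d Tr(Z) I - 2 Z - d T(Z)], which are completely positive, and their
    transforms under the exchange of [p] and [q], which are completely
    copositive.  Conversely [(d + 2) c + d (p + q)] is, up to a positive
    factor, the pairing of the Choi matrix with
    [I + sum E_ij (x) E_ij + sum E_ij (x) T(E_ij)], a matrix which is positive
    semidefinite and has positive semidefinite partial transpose, so that it
    pairs nonnegatively with every decomposable map. *)

Set Implicit Arguments.
Unset Strict Implicit.
Unset Printing Implicit Defensive.

Import Order.TTheory GRing.Theory Num.Theory.

Local Open Scope ring_scope.
Local Open Scope sesquilinear_scope.
Local Open Scope complex_scope.

(** * Positive semidefinite matrices *)

Lemma trmxC_mul (C : numClosedFieldType) (m n p : nat) (A : 'M[C]_(m, n))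
    (B : 'M[C]_(n, p)) : (A *m B)^t* = B^t* *m A^t*.
Proof. by rewrite trmx_mul map_mxM. Qed.

Lemma hermsymmxP (C : numClosedFieldType) (n : nat) (A : 'M[C]_n) :
  reflect (A^t* = A) (A \is hermsymmx).
Proof.
by apply: (iffP (is_hermitianmxP _ _ _)); rewrite expr0 scale1r => /esym.
Qed.

Lemma psdmx_conj (C : numClosedFieldType) (m n : nat) (V : 'M[C]_(m, n))
    (X : 'M[C]_n) : psdmx X -> psdmx (V *m X *m V^t*).
Proof.
case=> /hermsymmxP Xh Xge0; split=> [|v].
  by apply/hermsymmxP; rewrite !trmxC_mul trmxCK Xh mulmxA.
have := Xge0 (V^t* *m v).
by rewrite trmxC_mul trmxCK !mulmxA.
Qed.

Lemma psdmxD (C : numClosedFieldType) (n : nat) (A B : 'M[C]_n) :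
  psdmx A -> psdmx B -> psdmx (A + B).
Proof.
move=> [/hermsymmxP Ah A_ge0] [/hermsymmxP Bh B_ge0]; split=> [|v].
  by apply/hermsymmxP; rewrite linearD map_mxD Ah Bh.
by rewrite mulmxDr mulmxDl mxE addr_ge0.
Qed.

Lemma psdmx0 (C : numClosedFieldType) (n : nat) : psdmx (0 : 'M[C]_n).
Proof.
split=> [|v]; first by apply/hermsymmxP; rewrite trmx0 map_mx0.
by rewrite mulmx0 mul0mx mxE.
Qed.

Lemma psdmx_sum (C : numClosedFieldType) (n : nat) (I : finType)
    (F : I -> 'M[C]_n) :
  (forall i, psdmx (F i)) -> psdmx (\sum_i F i).
Proof.
by move=> Fp; apply: (big_ind (@psdmx C n)) => //;
   [exact: psdmx0 | exact: psdmxD].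
Qed.

Lemma psdmxZ (C : numClosedFieldType) (n : nat) (c : C) (A : 'M[C]_n) :
  0 <= c -> psdmx A -> psdmx (c *: A).
Proof.
move=> c_ge0 [/hermsymmxP Ah A_ge0]; split=> [|v].
  apply/hermsymmxP; rewrite linearZ /= map_mxZ Ah.
  by congr (_ *: _); apply/CrealP/ger0_real.
by rewrite -scalemxAr -scalemxAl mxE mulr_ge0.
Qed.

Lemma psdmx_gram (C : numClosedFieldType) (m n : nat) (V : 'M[C]_(m, n)) :
  psdmx (V *m V^t*).
Proof.
split=> [|v]; first by apply/hermsymmxP; rewrite trmxC_mul trmxCK.
have -> : v^t* *m (V *m V^t*) *m v = (V^t* *m v)^t* *m (V^t* *m v).
  by rewrite trmxC_mul trmxCK !mulmxA.
rewrite mxE sumr_ge0 // => i _.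
by rewrite mxE mxE mulrC mul_conjC_ge0.
Qed.

Lemma psdmx_diag_ge0 (C : numClosedFieldType) (n : nat) (A : 'M[C]_n) i :
  psdmx A -> 0 <= A i i.
Proof.
case=> _ /(_ (delta_mx i 0)).
by rewrite trmx_delta map_delta_mx -rowE -colE !mxE.
Qed.

Lemma psdmx_tr_ge0 (C : numClosedFieldType) (n : nat) (A : 'M[C]_n) :
  psdmx A -> 0 <= \tr A.
Proof. by move=> Ap; apply: sumr_ge0 => i _; apply: psdmx_diag_ge0. Qed.

(** The submatrix is V A V^* for the 0/1 selection matrix V = [rowsub f 1%:M], so [f] may be any
    map. It serves to pass between ['M_(1 * m)] and ['M_m]. *)
Lemma psdmx_mxsub (C : numClosedFieldType) (m n : nat) (f : 'I_m -> 'I_n)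
    (A : 'M[C]_n) : psdmx A -> psdmx (mxsub f f A).
Proof.
move=> /(psdmx_conj (rowsub f 1%:M)); congr psdmx.
rewrite mul_rowsub_mx mul1mx; apply/matrixP => i j; rewrite !mxE.
rewrite (bigD1 (f j)) //= big1 ?addr0 => [|k /negPf kj].
  by rewrite !mxE eqxx rmorph1 mulr1.
by rewrite !mxE eq_sym kj rmorph0 mulr0.
Qed.

(** The form of A at v is the form of the transpose of A at the conjugate of v, as transposing a 1 x
    1 matrix shows. *)
Lemma psdmx_tr (C : numClosedFieldType) (n : nat) (A : 'M[C]_n) :
  psdmx A^T -> psdmx A.
Proof.
case=> /hermsymmxP AH A_ge0.
have AC : map_mx Num.conj A = A^T by rewrite -{1}[A]trmxK.
split=> [|v]; first by apply/hermsymmxP; rewrite -map_trmx AC trmxK.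
have := A_ge0 (map_mx Num.conj v); congr (0 <= _).
rewrite -[LHS]trace_mx11 -mxtrace_tr trace_mx11 !trmx_mul trmxK.
rewrite -map_trmx trmxK mulmxA; congr ((_ *m _) 0 0);
  first by rewrite map_trmx.
by apply/matrixP => i j; rewrite !mxE conjCK.
Qed.

(** * Complete positivity *)

Lemma delta_mxE (K : pzSemiRingType) (m n : nat) (i : 'I_m) (j : 'I_n) a b :
  (delta_mx i j : 'M[K]_(m, n)) a b = (a == i)%:R * (b == j)%:R.
Proof. by rewrite mxE -mulnb natrM. Qed.

Lemma tensmxDr (K : comPzRingType) (k l m n : nat) (A : 'M[K]_(k, l))
    (B C : 'M[K]_(m, n)) : A *t (B + C) = A *t B + A *t C.
Proof. by apply/matrixP => r s; rewrite !mxE mulrDr. Qed.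

Lemma tensmxZr (K : comPzRingType) (k l m n : nat) (c : K) (A : 'M[K]_(k, l))
    (B : 'M[K]_(m, n)) : A *t (c *: B) = c *: (A *t B).
Proof. by apply/matrixP => r s; rewrite !mxE mulrCA. Qed.

Lemma tensmx_sumr (K : comPzRingType) (k l m n : nat) (I : Type) (r : seq I)
    (P : pred I) (A : 'M[K]_(k, l)) (B : I -> 'M[K]_(m, n)) :
  A *t (\sum_(i <- r | P i) B i) = \sum_(i <- r | P i) A *t B i.
Proof.
by apply: (big_morph (tensmx A)) => [X Y|]; rewrite ?tensmxDr ?tensmx0.
Qed.

Lemma tensblock_sum (K : pzRingType) (k m : nat) (X : 'M[K]_(k * m)) :
  X = \sum_i \sum_j delta_mx i j *t tensblock X i j.
Proof.
apply/matrixP => r s.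
case: (mxtens_indexP r) => i a; case: (mxtens_indexP s) => j b.
rewrite summxE (bigD1 i) //= summxE (bigD1 j) //= !tensmxE !mxE !eqxx mul1r.
rewrite !big1 ?addr0 // => [i' /negPf ne|j' /negPf ne].
  by rewrite summxE big1 // => j' _; rewrite tensmxE mxE eq_sym ne mul0r.
by rewrite tensmxE mxE eqxx eq_sym ne mul0r.
Qed.

Lemma completely_positive_comb (C : numClosedFieldType) (m n : nat) (a b : C)
    (L L1 L2 : {linear 'M[C]_m -> 'M[C]_n}) :
  0 <= a -> 0 <= b -> completely_positive L1 -> completely_positive L2 ->
  (forall Z, L Z = a *: L1 Z + b *: L2 Z) -> completely_positive L.
Proof.
move=> a_ge0 b_ge0 cp1 cp2 LE k k_gt0 X Xp; rewrite /=.
suff -> : id_tens L X = a *: id_tens L1 X + b *: id_tens L2 X.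
  by apply: psdmxD; apply: psdmxZ => //; [exact: (cp1 k) | exact: (cp2 k)].
apply/matrixP => r s.
case: (mxtens_indexP r) => i u; case: (mxtens_indexP s) => j v.
by rewrite id_tensE LE !mxE !id_tensE.
Qed.

Lemma completely_positive_conj (C : numClosedFieldType) (m n n' : nat)
    (V : 'M[C]_(n', n)) (L : {linear 'M[C]_m -> 'M[C]_n})
    (L' : {linear 'M[C]_m -> 'M[C]_n'}) :
  completely_positive L -> (forall Z, L' Z = V *m L Z *m V^t*) ->
  completely_positive L'.
Proof.
move=> cpL LE k k_gt0 X Xp; rewrite /=.
suff -> : id_tens L' X = (1%:M *t V) *m id_tens L X *m (1%:M *t V)^t*.
  by apply: psdmx_conj; apply: (cpL k).
rewrite mulmx_sumr mulmx_suml; apply: eq_bigr => i _.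
rewrite mulmx_sumr mulmx_suml; apply: eq_bigr => j _.
by rewrite LE trmx_tens map_mxT trmx1 map_mx1 !tensmx_mul mul1mx mulmx1.
Qed.

(** Amplifying by the identity turns each Kraus operator V into 1 (x) V, so the amplified map is
    again a nonnegative multiple of a sum of conjugations. *)
Lemma completely_positive_kraus (C : numClosedFieldType) (m n : nat) (c : C)
    (I : finType) (V : I -> 'M[C]_(n, m)) (L : {linear 'M[C]_m -> 'M[C]_n}) :
  0 <= c -> (forall Z, L Z = c *: \sum_s V s *m Z *m (V s)^t*) ->
  completely_positive L.
Proof.
move=> c_ge0 LE k _ X Xp; rewrite /=.
suff -> : id_tens L X = c *: \sum_s (1%:M *t V s) *m X *m (1%:M *t V s)^t*.
  by apply: psdmxZ => //; apply: psdmx_sum => s; apply: psdmx_conj.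
under eq_bigr => s _ do rewrite {1}(tensblock_sum X) mulmx_sumr mulmx_suml.
rewrite exchange_big scaler_sumr; apply: eq_bigr => i _.
under [in RHS]eq_bigr => s _ do rewrite mulmx_sumr mulmx_suml.
rewrite exchange_big scaler_sumr; apply: eq_bigr => j _.
rewrite LE tensmxZr tensmx_sumr; congr (_ *: _); apply: eq_bigr => s _.
by rewrite trmx_tens map_mxT trmx1 map_mx1 !tensmx_mul mul1mx mulmx1.
Qed.

Lemma sum_mxtens (K : nmodType) (k n : nat) (F : 'I_(k * n) -> K) :
  \sum_r F r = \sum_i \sum_a F (mxtens_index (i, a)).
Proof.
rewrite pair_bigA (reindex (@mxtens_index k n)) /=.
  by apply: eq_bigr => -[].
by exists (@mxtens_unindex k n) => r _;
  rewrite ?mxtens_indexK ?mxtens_unindexK.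
Qed.

Lemma completely_positive_choi (C : numClosedFieldType) (m n : nat)
    (L : {linear 'M[C]_m -> 'M[C]_n}) (V : 'M[C]_(n, m)) :
  completely_positive L ->
  0 <= \sum_i \sum_j (V^t* *m L (delta_mx i j) *m V) i j.
Proof.
(* [w w^*] is the unnormalized maximally entangled state: the form of the Choi
   matrix is evaluated at [x], the vectorization of [V]. *)
case: m L V => [|m] L V cpL; first by rewrite big_ord0.
pose w : 'cV[C]_(m.+1 * m.+1) := \col_r
  ((mxtens_unindex r).1 == (mxtens_unindex r).2)%:R.
pose x : 'cV[C]_(m.+1 * n) :=
  \col_r V (mxtens_unindex r).2 (mxtens_unindex r).1.
have wE i j : tensblock (w *m w^t*) i j = delta_mx i j.
  apply/matrixP => a b; rewrite delta_mxE mxE mxE big_ord1 !mxE.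
  by rewrite !mxtens_indexK /= conjC_nat ![_ == a]eq_sym ![_ == b]eq_sym.
have [_ /(_ x)] := cpL m.+1 isT _ (psdmx_gram w).
rewrite /= mxE; congr (_ <= _).
rewrite sum_mxtens [RHS]exchange_big; apply: eq_bigr => j _.
under [RHS]eq_bigr => i _ do rewrite mxE.
rewrite [RHS]exchange_big; apply: eq_bigr => b _.
rewrite mxE mulr_suml sum_mxtens; apply: eq_bigr => i _.
rewrite [in RHS]mxE mulr_suml; apply: eq_bigr => a _.
by rewrite id_tensE wE !mxE !mxtens_indexK.
Qed.

Lemma eq_positive_map (C : numClosedFieldType) (m n : nat)
    (L L' : {linear 'M[C]_m -> 'M[C]_n}) :
  L =1 L' -> positive_map L -> positive_map L'.
Proof. by move=> LE Lp Z /Lp; rewrite LE. Qed.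

(** This is the case k = 1, up to the reindexing of ['I_(1 * m)] by ['I_m]. *)
Lemma completely_positive_positive (C : numClosedFieldType) (m n : nat)
    (L : {linear 'M[C]_m -> 'M[C]_n}) :
  completely_positive L -> positive_map L.
Proof.
move=> cpL Z Zp; pose g (r : 'I_(1 * m)) := (mxtens_unindex r).2.
have := psdmx_mxsub (fun a => mxtens_index (0, a))
  (cpL 1%N isT _ (psdmx_mxsub g Zp)).
congr psdmx; apply/matrixP => a b; rewrite mxE /= id_tensE; congr (L _ a b).
by apply/matrixP => i j; rewrite !mxE /g !mxtens_indexK.
Qed.

Lemma decomposable_positive (C : numClosedFieldType) (m n : nat)
    (L : {linear 'M[C]_m -> 'M[C]_n}) : decomposable L -> positive_map L.
Proof.
case=> L1 [L2 [cp1 cocp2 LE]] Z Zp; rewrite LE; apply: psdmxD.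
  exact: completely_positive_positive.
by apply: psdmx_tr; apply: (completely_positive_positive cocp2 Zp).
Qed.

Lemma eq_decomposable (C : numClosedFieldType) (m n : nat)
    (L L' : {linear 'M[C]_m -> 'M[C]_n}) :
  L =1 L' -> decomposable L -> decomposable L'.
Proof.
by move=> LE [L1 [L2 [cp1 cp2 LL]]]; exists L1, L2; split=> // Z; rewrite -LE.
Qed.

(** * Matrix units and a trace inequality *)

Lemma mulmx_delta_delta (K : comNzRingType) (m n p q : nat)
    (X : 'M[K]_(n, p)) (a : 'I_m) b c (d : 'I_q) :
  delta_mx a b *m X *m delta_mx c d = X b c *: delta_mx a d.
Proof.
have -> : delta_mx a b *m X *m delta_mx c d
    = delta_mx a 0 *m (delta_mx (0 : 'I_1) b *m X *m delta_mx c (0 : 'I_1))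
      *m delta_mx 0 d.
  by rewrite -[delta_mx a b](mul_delta_mx (0 : 'I_1))
    -[delta_mx c d](mul_delta_mx (0 : 'I_1)) !mulmxA.
rewrite -rowE -colE [col c _]mx11_scalar mxE mxE mul_mx_scalar -scalemxAl.
by rewrite mul_delta_mx.
Qed.

(** Since E_ab X E_cd = X_bc E_ad, two of the four terms of each product sum to the trace and the
    other two to the transpose. The sign e = -1 yields Kraus operators for the boundary map, and e =
    1 yields the symmetric vectors used against the Choi matrix. *)
Lemma sum_delta_conj (K : comNzRingType) (n : nat) (e : K) (X : 'M[K]_n) :
  e ^+ 2 = 1 ->
  \sum_a \sum_b (delta_mx a b + e *: delta_mx b a) *m X
    *m (delta_mx a b + e *: delta_mx b a)^T
  = ((\tr X)%:M + e *: X^T) *+ 2.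
Proof.
move=> e2.
have trE : \sum_a \sum_b X b b *: delta_mx a a = (\tr X)%:M :> 'M_n.
  rewrite exchange_big -scalemx1 /mxtrace scaler_suml; apply: eq_bigr => b _.
  by rewrite -scaler_sumr -mx1_sum_delta.
have trE' : \sum_a \sum_b X a a *: delta_mx b b = (\tr X)%:M :> 'M_n.
  by rewrite exchange_big.
have XE : \sum_a \sum_b e *: (X a b *: delta_mx b a) = e *: X^T.
  rewrite exchange_big [X^T]matrix_sum_delta scaler_sumr.
  apply: eq_bigr => a _; rewrite scaler_sumr; apply: eq_bigr => b _.
  by rewrite mxE.
have XE' : \sum_a \sum_b e *: (X b a *: delta_mx a b) = e *: X^T.
  by rewrite exchange_big.
transitivity (\sum_a \sum_b
    (X b b *: delta_mx a a + e *: (X b a *: delta_mx a b)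
    + (e *: (X a b *: delta_mx b a) + X a a *: delta_mx b b))).
  apply: eq_bigr => a _; apply: eq_bigr => b _.
  rewrite linearD linearZ /= !trmx_delta !(mulmxDl, mulmxDr).
  rewrite -!(scalemxAl, scalemxAr) !mulmx_delta_delta.
  by rewrite [e *: (e *: _)]scalerA -expr2 e2 scale1r.
under eq_bigr => a _ do rewrite !big_split.
rewrite !big_split /= trE trE' XE XE'.
by rewrite mulr2n [e *: _ + _]addrC.
Qed.

Lemma mulmx_deltaE (K : pzSemiRingType) (m n p q : nat) (A : 'M[K]_(m, n))
    (B : 'M[K]_(p, q)) a b i j :
  (A *m delta_mx a b *m B) i j = A i a * B b j.
Proof.
rewrite -(mul_delta_mx (0 : 'I_1)) mulmxA -mulmxA -rowE -colE.
by rewrite !mxE big_ord1 !mxE.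
Qed.

(** With a = |u|^2 and P = a I - u u^* - w w^*, the difference of the two sides is Tr(Z P). As P is
    hermitian with P^2 = a P, a Tr(Z P) = Tr(P Z P) is nonnegative. *)
Lemma psdmx_tr_orthogonal_pair (C : numClosedFieldType) (n : nat)
    (Z : 'M[C]_n) (u w : 'cV[C]_n) :
  psdmx Z -> u^t* *m w = 0 -> u^t* *m u = w^t* *m w ->
  (u^t* *m Z *m u + w^t* *m Z *m w) 0 0 <= \tr Z * (u^t* *m u) 0 0.
Proof.
move=> Zp uw0 uu_ww; set a := (u^t* *m u) 0 0.
have uuE : u^t* *m u = a%:M by rewrite [LHS]mx11_scalar.
have wwE : w^t* *m w = a%:M by rewrite -uu_ww.
have wu0 : w^t* *m u = 0.
  by rewrite -[w^t* *m u]trmxCK trmxC_mul trmxCK uw0 trmx0 map_mx0.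
have a_ge0 : 0 <= a.
  rewrite /a mxE sumr_ge0 // => i _; rewrite mxE mxE mulrC.
  exact: mul_conjC_ge0.
(* [P] is [a] times an orthogonal projector. *)
pose P := a%:M - u *m u^t* - w *m w^t*.
have PE : P *m P = a *: P.
  rewrite {1}/P !mulmxBl mul_scalar_mx.
  have -> : u *m u^t* *m P = 0.
    rewrite /P !mulmxBr mul_mx_scalar !mulmxA.
    rewrite -(mulmxA u (u^t*) u) uuE -(mulmxA u (u^t*) w) uw0 mul_mx_scalar.
    by rewrite mulmx0 mul0mx subr0 -scalemxAl subrr.
  have -> : w *m w^t* *m P = 0.
    rewrite /P !mulmxBr mul_mx_scalar !mulmxA.
    rewrite -(mulmxA w (w^t*) w) wwE -(mulmxA w (w^t*) u) wu0 mul_mx_scalar.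
    by rewrite mulmx0 mul0mx subr0 -scalemxAl subrr.
  by rewrite !subr0.
have PH : P^t* = P.
  rewrite /P !linearB /= !map_mxB !trmxC_mul !trmxCK tr_scalar_mx map_scalar_mx.
  by rewrite /= (CrealP _) // ger0_real.
have trPE : \tr (Z *m P)
    = \tr Z * a - (u^t* *m Z *m u + w^t* *m Z *m w) 0 0.
  rewrite /P !mulmxBr !linearB /= mul_mx_scalar linearZ /= mulrC !mulmxA.
  rewrite mxtrace_mulC (mxtrace_mulC (Z *m w)) /mxtrace !big_ord1.
  by rewrite [in RHS]mxE !mulmxA opprD addrA.
rewrite -subr_ge0 -trPE.
(* The factor a can be cancelled only if it is nonzero; otherwise u = w = 0 and P = 0. *)
have [a0|a_neq0] := eqVneq a 0.
  have z0 (v : 'cV[C]_n) : v^t* *m v = a%:M -> v = 0.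
    move=> /matrixP /(_ 0 0); rewrite a0 !mxE => /eqP.
    rewrite psumr_eq0 => [/allP v0|i _]; last first.
      by rewrite mxE mxE mulrC mul_conjC_ge0.
    apply/matrixP => i j; rewrite ord1 mxE; apply/eqP.
    by have := v0 i (mem_index_enum i); rewrite !mxE mulrC mul_conjC_eq0.
  by rewrite /P a0 (z0 u) // (z0 w) // !mul0mx raddf0 !subr0 mulmx0 mxtrace0.
have := psdmx_tr_ge0 (psdmx_conj P Zp).
rewrite PH mxtrace_mulC mulmxA PE -scalemxAl mxtraceZ pmulr_rge0.
  by rewrite mxtrace_mulC.
by rewrite lt_def a_neq0.
Qed.

(** * Maps covariant under the symplectic conjugation *)

(** The first two conditions together force the entries of J to be real. With the third, J is real
    orthogonal; the arguments of this section use nothing else about Omega. *)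
Definition real_symplectic (C : numClosedFieldType) (d : nat) (J : 'M[C]_d) :=
  [/\ J^T = - J, J^t* = - J & J *m J = - 1%:M].

(** The trace coefficient [c] is independent of [p] and [q], so that the family is closed under
    linear combinations and conic decompositions stay inside it. *)
Definition covmap (C : numClosedFieldType) (d : nat) (J : 'M[C]_d)
    (c p q : C) (Z : 'M[C]_d) : 'M[C]_d :=
  (c * \tr Z)%:M + p *: Z + q *: (J *m Z^T *m J^t*).

Fact covmap_is_linear (C : numClosedFieldType) (d : nat) (J : 'M[C]_d)
    (c p q : C) : linear (covmap J c p q).
Proof.
move=> a X Y; rewrite /covmap !linearP /= mulmxDl -scalemxAl.
by apply/matrixP => i j; rewrite !mxE; ring.
Qed.

HB.instance Definition _ (C : numClosedFieldType) (d : nat) (J : 'M[C]_d)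
    (c p q : C) :=
  GRing.isLinear.Build C 'M[C]_d 'M[C]_d *:%R
    (covmap J c p q) (covmap_is_linear J c p q).

Lemma covmap_positive (C : numClosedFieldType) (d : nat) (J : 'M[C]_d)
    (c p q : C) :
  real_symplectic J -> p \is Num.real -> q \is Num.real ->
  0 <= c -> 0 <= c + p -> 0 <= c + q -> positive_map (covmap J c p q).
Proof.
case=> JT JH JJ p_real q_real c_ge0 cp_ge0 cq_ge0 Z Zp /=.
have [/hermsymmxP ZH Z_ge0] := Zp.
split=> [|u].
  apply/hermsymmxP; rewrite /covmap !linearD !linearZ /= !map_mxD !map_mxZ.
  rewrite !trmxC_mul trmxCK tr_scalar_mx map_scalar_mx /= !mulmxA.
  rewrite !(CrealP _) //; last by rewrite realM ?ger0_real ?psdmx_tr_ge0.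
  have ZC : map_mx Num.conj Z = Z^T by rewrite -[LHS]trmxK map_trmx ZH.
  by rewrite ZH trmxK ZC.
pose w := J *m map_mx Num.conj u.
have uw0 : u^t* *m w = 0.
  apply/matrixP => i j; rewrite !ord1 [RHS]mxE.
  (* With v the conjugate of u, this scalar is v^T J v, which antisymmetry of J makes equal to its
     own opposite. *)
  have : (u^t* *m w)^T 0 0 = - (u^t* *m w) 0 0.
    by rewrite /w -map_trmx !trmx_mul JT trmxK mulmxN mulNmx -mulmxA mxE mulmxA.
  rewrite mxE => /eqP; rewrite -addr_eq0 -mulr2n mulrn_eq0 => /eqP; exact.
have wH : w^t* = - u^T *m J.
  rewrite trmxC_mul JH mulmxN mulNmx -map_trmx -map_mx_comp.
  by rewrite map_mx_id // => x /=; rewrite conjCK.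
have uu_ww : u^t* *m u = w^t* *m w.
  rewrite wH /w !mulNmx -mulmxA (mulmxA J J) JJ mulNmx mul1mx mulmxN opprK.
  rewrite -[RHS]trmxK trmx_mul trmxK map_trmx.
  by apply/matrixP => i j; rewrite !ord1 [RHS]mxE.
have -> : (u^t* *m covmap J c p q Z *m u) 0 0
    = c * (\tr Z * (u^t* *m u) 0 0
           - (u^t* *m Z *m u + w^t* *m Z *m w) 0 0)
      + (c + p) * (u^t* *m Z *m u) 0 0 + (c + q) * (w^t* *m Z *m w) 0 0.
  have -> : w^t* *m Z *m w = u^t* *m (J *m Z^T *m J^t*) *m u.
    apply/matrixP => i j; rewrite !ord1 -[RHS]trace_mx11 -mxtrace_tr.
    rewrite trace_mx11; congr (_ 0 0).
    by rewrite wH /w JH !trmx_mul trmxK linearN /= JT opprK map_trmx trmxK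
      !(mulNmx, mulmxN) !mulmxA.
  rewrite mulmxDr mulmxDr !mulmxDl mul_mx_scalar -!scalemxAr -!scalemxAl.
  move: (\tr Z) (u^t* *m u) (u^t* *m Z *m u) (u^t* *m (J *m _ *m _) *m u).
  move=> t A B D.
  by rewrite !mxE; ring.
rewrite !addr_ge0 // mulr_ge0 // subr_ge0.
exact: psdmx_tr_orthogonal_pair.
Qed.

(** Conjugation by J undoes the twist in J Z^T J^* because J^2 = -1. Hence complete positivity for
    (p, q) becomes complete copositivity for (q, p). *)
Lemma covmap_swap (C : numClosedFieldType) (d : nat) (J : 'M[C]_d) (c p q : C)
    (Z : 'M[C]_d) :
  real_symplectic J ->
  (covmap J c q p Z)^T = J *m covmap J c p q Z *m J^t*.
Proof.
case=> JT JH JJ; rewrite /covmap !linearD !linearZ /= JH.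
rewrite !trmx_mul trmxK tr_scalar_mx !linearN /= JT.
rewrite mulmxBl mulmxDl mul_mx_scalar -!scalemxAl !mulmxA JJ.
rewrite -[_ *m J *m J]mulmxA JJ !(mulNmx, mulmxN) mul1mx mulmx1 !opprK.
by rewrite !scalerN scalemx1 !opprD !opprK [RHS]addrAC.
Qed.

(** * The nontrivial completely positive generator *)

Lemma real_symplectic_sqr_sum (C : numClosedFieldType) (d : nat)
    (J : 'M[C]_d) :
  real_symplectic J -> \sum_a \sum_b J a b ^+ 2 = d%:R.
Proof.
case=> JT JH JJ; rewrite -(mxtrace1 C) -[1%:M]opprK -JJ -mulmxN -JT.
by apply: eq_bigr => a _; rewrite mxE; apply: eq_bigr => b _; rewrite mxE.
Qed.

Lemma covmap_cp_boundary (C : numClosedFieldType) (d : nat) (J : 'M[C]_d) :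
  (0 < d)%N -> real_symplectic J ->
  completely_positive (covmap J d%:R (- 2) (- d%:R)).
Proof.
move=> d_gt0 Jsymp; have [JT JH JJ] := Jsymp.
have d_neq0 : d%:R != 0 :> C by rewrite pnatr_eq0 -lt0n.
pose S (a b : 'I_d) : 'M[C]_d := delta_mx a b + -1 *: delta_mx b a.
(* The trace of [J *m S a b] is -2 J_ab, which the scalar matrix [t a b] cancels. *)
pose t (a b : 'I_d) : C := 2 / d%:R * J a b.
have ST a b : (S a b)^T = - S a b.
  by rewrite /S linearD linearZ /= !trmx_delta !scaleN1r opprB.
have SH a b : (S a b)^t* = - S a b.
  by rewrite ST map_mxN map_mxD map_mxZ !map_delta_mx rmorphN1.
have tC a b : Num.conj (t a b) = t a b.
  rewrite rmorphM rmorphM fmorphV /= !conjC_nat; congr (_ * _).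
  move/matrixP: JH => /(_ a b).
  by rewrite JT !mxE rmorphN => /oppr_inj.
have WH a b : (J *m S a b + (t a b)%:M)^t* = S a b *m J + (t a b)%:M.
  rewrite linearD /= map_mxD trmxC_mul tr_scalar_mx map_scalar_mx /= tC SH JH.
  by rewrite mulmxN mulNmx opprK.
have sum_tS : \sum_a \sum_b t a b *: S a b = (4 / d%:R) *: J.
  rewrite (_ : 4 / d%:R = (2 / d%:R) * 2); last by field.
  rewrite -scalerA scalerDl !scale1r -{2}[J]opprK -JT.
  rewrite [in RHS](matrix_sum_delta J) linear_sum -sumrB scaler_sumr.
  apply: eq_bigr => a _; rewrite linear_sum -sumrB scaler_sumr.
  apply: eq_bigr => b _.
  by rewrite linearZ /= trmx_delta -scalerBr scalerA /S scaleN1r.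
have sum_t2 : \sum_a \sum_b t a b ^+ 2 = 4 / d%:R.
  transitivity ((2 / d%:R) ^+ 2 * \sum_a \sum_b J a b ^+ 2).
    rewrite mulr_sumr; apply: eq_bigr => a _; rewrite mulr_sumr.
    by apply: eq_bigr => b _; rewrite exprMn.
  by rewrite real_symplectic_sqr_sum //; field.
(* The Kraus operators are [J (E_ab - E_ba)] made traceless: without the scalar
   correction one gets [Tr(Z) I - J Z^T J^*], and the correction subtracts the
   multiple of [Z]. *)
apply: (@completely_positive_kraus _ _ _ (d%:R / 2) ('I_d * 'I_d)%type
  (fun s => J *m S s.1 s.2 + (t s.1 s.2)%:M)).
  by rewrite divr_ge0 ?ler0n.
move=> Z.
rewrite -(pair_bigA _ (fun a b => (J *m S a b + (t a b)%:M) *m Z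
  *m (J *m S a b + (t a b)%:M)^t*)) /=.
(* Summed over a and b, the cross terms give (4/d)(J J Z + Z J J) = -(8/d) Z and the squares of [t]
   give (4/d) Z. The factor d/2 then leaves -2 Z. *)
transitivity ((d%:R / 2) *: \sum_a \sum_b
  (J *m (S a b *m Z *m (S a b)^T) *m J^t*
   + (J *m (t a b *: S a b) *m Z + Z *m (t a b *: S a b) *m J)
   + t a b ^+ 2 *: Z)); last first.
  congr (_ *: _); apply: eq_bigr => a _; apply: eq_bigr => b _.
  move: (S a b) (ST a b) (WH a b) => s -> ->.
  rewrite JH !(mulmxDl, mulmxDr) !mul_scalar_mx !mul_mx_scalar expr2 -scalerA.
  rewrite !(mulmxN, mulNmx, opprK) -!scalemxAr -!scalemxAl !mulmxA.
  by rewrite [RHS]addrACA !addrA.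
have sum_in (A B : 'M[C]_d) (F : 'I_d -> 'I_d -> 'M[C]_d) :
    \sum_a \sum_b A *m F a b *m B = A *m (\sum_a \sum_b F a b) *m B.
  rewrite mulmx_sumr mulmx_suml; apply: eq_bigr => a _.
  by rewrite mulmx_sumr mulmx_suml.
under eq_bigr => a _ do rewrite !big_split /= -scaler_suml.
rewrite !big_split /= -scaler_suml !sum_in sum_delta_conj ?sqrrN ?expr1n //.
rewrite sum_tS sum_t2 -!scalemxAr -!scalemxAl -[Z *m J *m J]mulmxA JJ.
rewrite mulNmx mulmxN mul1mx mulmx1 scaleN1r -scaler_nat -scalemxAr -scalemxAl.
rewrite mulmxBr mulmxBl mul_mx_scalar -!scalemxAl {1}JH mulmxN JJ opprK.
rewrite /covmap -scalemx1; move: (J *m _ *m _) (\tr Z) => Y u.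
by apply/matrixP => i j; rewrite !mxE; field.
Qed.

(** * The functional obstructing decomposability *)

(* The pairing of the Choi matrix of [L] with the PPT matrix
   [I + sum E_ij (x) E_ij + sum E_ij (x) J E_ji J^*]. *)
Definition sym_functional (C : numClosedFieldType) (d : nat) (J : 'M[C]_d)
    (L : 'M[C]_d -> 'M[C]_d) : C :=
  \sum_i \tr (L (delta_mx i i)) + \sum_i \sum_j L (delta_mx i j) i j
  + \sum_i \sum_j (J^t* *m L (delta_mx i j) *m J) j i.

(* [I + flip] is half the sum of the projectors on the symmetric vectors
   [e_a (x) e_b + e_b (x) e_a], here rotated by [1 (x) U]. *)
Lemma choi_symmetric_ge0 (C : numClosedFieldType) (d : nat) (U : 'M[C]_d)
    (L : {linear 'M[C]_d -> 'M[C]_d}) :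
  U *m U^t* = 1%:M -> completely_positive L ->
  0 <= \sum_i \tr (L (delta_mx i i))
       + \sum_i \sum_j (U^t* *m L (delta_mx i j) *m U) j i.
Proof.
move=> UU cpL.
pose S (a b : 'I_d) : 'M[C]_d := delta_mx a b + 1 *: delta_mx b a.
have ST a b : (S a b)^T = S a b.
  by rewrite /S linearD linearZ /= !trmx_delta !scale1r addrC.
have SC a b : (S a b)^t* = (S a b)^T.
  by rewrite ST /S map_mxD map_mxZ !map_delta_mx rmorph1.
have : 0 <= \sum_a \sum_b \sum_i \sum_j
    ((U *m S a b)^t* *m L (delta_mx i j) *m (U *m S a b)) i j.
  do 2 (apply: sumr_ge0 => ? _); exact: completely_positive_choi.
suff -> : \sum_a \sum_b \sum_i \sum_j
    ((U *m S a b)^t* *m L (delta_mx i j) *m (U *m S a b)) i j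
  = (\sum_i \tr (L (delta_mx i i))
    + \sum_i \sum_j (U^t* *m L (delta_mx i j) *m U) j i) *+ 2.
  by rewrite pmulrn_lge0.
under eq_bigr => a _ do rewrite exchange_big.
rewrite exchange_big -big_split -sumrMnl; apply: eq_bigr => i _.
under eq_bigr => a _ do rewrite exchange_big.
rewrite exchange_big /=.
(* For fixed i and j, the sum over a and b is [sum_delta_conj] with e = 1 at X = U^* L(E_ij) U,
   whose trace is that of L(E_ij) by unitarity. *)
transitivity (\sum_j ((\tr (L (delta_mx i j)))%:M i j
  + (U^t* *m L (delta_mx i j) *m U) j i) *+ 2).
  apply: eq_bigr => j _.
  have := sum_delta_conj (U^t* *m L (delta_mx i j) *m U) (expr1n C 2).
  move/matrixP/(_ i j); rewrite mxtrace_mulC mulmxA UU mul1mx scale1r => E.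
  rewrite [RHS](_ : _ = (((\tr (L (delta_mx i j)))%:M
    + (U^t* *m L (delta_mx i j) *m U)^T) *+ 2) i j); last first.
    by rewrite !mulr2n !mxE.
  rewrite -E summxE; apply: eq_bigr => a _; rewrite summxE.
  by apply: eq_bigr => b _; rewrite trmxC_mul SC ST !mulmxA.
rewrite sumrMnl big_split /=; congr ((_ + _) *+ 2).
rewrite (bigD1 i) //= big1 ?addr0 => [|j /negPf ji].
  by rewrite mxE eqxx.
by rewrite mxE eq_sym ji.
Qed.

(** The first and third sums form the symmetric pairing rotated by J, and the second is the Choi
    form at the identity. *)
Lemma sym_functional_cp (C : numClosedFieldType) (d : nat) (J : 'M[C]_d)
    (L : {linear 'M[C]_d -> 'M[C]_d}) :
  real_symplectic J -> completely_positive L -> 0 <= sym_functional J L.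
Proof.
case=> JT JH JJ cpL; rewrite /sym_functional addrAC addr_ge0 //.
  apply: choi_symmetric_ge0 => //.
  by rewrite JH mulmxN JJ opprK.
have := completely_positive_choi 1%:M cpL.
rewrite trmx1 map_mx1.
by under eq_bigr => i _ do under eq_bigr => j _ do rewrite mulmx1 mul1mx.
Qed.

(** Transposing the output exchanges the roles: the first two sums form the unrotated symmetric
    pairing, and the third is the Choi form at J. *)
Lemma sym_functional_cocp (C : numClosedFieldType) (d : nat) (J : 'M[C]_d)
    (L : {linear 'M[C]_d -> 'M[C]_d}) :
  real_symplectic J -> completely_copositive L -> 0 <= sym_functional J L.
Proof.
case=> JT JH JJ cpL; rewrite /sym_functional addr_ge0 //.
  have := choi_symmetric_ge0 (U := 1%:M) _ cpL.
  rewrite trmx1 map_mx1 mulmx1 => /(_ erefl); congr (0 <= _ + _).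
    by apply: eq_bigr => i _; rewrite /= mxtrace_tr.
  apply: eq_bigr => i _; apply: eq_bigr => j _.
  by rewrite mulmx1 mul1mx /= mxE.
have := completely_positive_choi J cpL; congr (0 <= _).
apply: eq_bigr => i _; apply: eq_bigr => j _ /=.
have -> : (J^t* *m (L (delta_mx i j))^T *m J)
   = (J^t* *m L (delta_mx i j) *m J)^T.
  by rewrite !trmx_mul JH linearN /= JT opprK mulmxA !(mulNmx, mulmxN).
by rewrite mxE.
Qed.

Lemma sym_functionalD (C : numClosedFieldType) (d : nat) (J : 'M[C]_d)
    (L L1 L2 : 'M[C]_d -> 'M[C]_d) :
  (forall Z, L Z = L1 Z + L2 Z) ->
  sym_functional J L = sym_functional J L1 + sym_functional J L2.
Proof.
move=> LE; rewrite /sym_functional [RHS]addrACA [X in _ = X + _]addrACA.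
congr (_ + _ + _); rewrite -big_split; apply: eq_bigr => i _ /=.
- by rewrite LE linearD.
- by rewrite -big_split; apply: eq_bigr => j _; rewrite LE mxE.
- rewrite -big_split; apply: eq_bigr => j _.
  by rewrite LE mulmxDr mulmxDl mxE.
Qed.

Lemma sym_functional_covmap (C : numClosedFieldType) (d : nat) (J : 'M[C]_d)
    (c p q : C) :
  real_symplectic J ->
  sym_functional J (covmap J c p q)
  = d%:R * ((d%:R + 2) * c + d%:R * (p + q)).
Proof.
move=> Jsymp; have [JT JH JJ] := Jsymp.
have JHE a b : (J^t* : 'M_d) a b = - J a b by rewrite JH mxE.
have JJH : J *m J^t* = 1%:M by rewrite JH mulmxN JJ opprK.
have JHJ : J^t* *m J = 1%:M by rewrite JH mulNmx JJ opprK.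
have Jba a b : J b a = - J a b.
  by move/matrixP: JT => /(_ a b); rewrite !mxE.
have sumd (x : C) : \sum_(i < d) x = d%:R * x.
  by rewrite sumr_const card_ord mulr_natl.
have sum_diag (x : C) : \sum_(i < d) \sum_(j < d) (i == j)%:R * x = d%:R * x.
  rewrite -sumd; apply: eq_bigr => i _; rewrite (bigD1 i) //= eqxx mul1r.
  by rewrite big1 ?addr0 // => j; rewrite eq_sym => /negPf ->; rewrite mul0r.
have sumJ : \sum_i \sum_j J i j ^+ 2 = d%:R.
  exact: real_symplectic_sqr_sum.
have trd (i j : 'I_d) : \tr (delta_mx i j : 'M[C]_d) = (i == j)%:R.
  rewrite /mxtrace (bigD1 i) //= big1 => [|k /negPf ki].
    by rewrite mxE eqxx addr0.
  by rewrite mxE ki.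
rewrite /sym_functional.
have -> : \sum_i \tr (covmap J c p q (delta_mx i i))
    = d%:R * (d%:R * c + p + q).
  rewrite -sumd; apply: eq_bigr => i _; rewrite /covmap !linearD !linearZ /=.
  rewrite mxtrace_scalar -(mulmxA J) mxtrace_mulC -mulmxA mxtrace_mulC JHJ.
  by rewrite mul1mx trmx_delta trd eqxx !mulr1 mulr_natl.
have -> : \sum_i \sum_j covmap J c p q (delta_mx i j) i j
    = d%:R * c + d%:R * (d%:R * p) - q * d%:R.
  transitivity
    (\sum_(i < d) \sum_(j < d) ((i == j)%:R * c + p + - q * J i j ^+ 2)).
    apply: eq_bigr => i _; apply: eq_bigr => j _.
    rewrite /covmap trmx_delta mxE [X in X + _]mxE [X in _ + X]mxE.
    rewrite mulmx_deltaE JHE trd !mxE !eqxx.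
    by case: eqVneq => [->|_] /=; ring.
  under eq_bigr => i _ do rewrite !big_split /= -mulr_sumr sumd.
  by rewrite !big_split /= -!mulr_sumr !sumd sum_diag sumJ; ring.
have -> : \sum_i \sum_j (J^t* *m covmap J c p q (delta_mx i j) *m J) j i
    = d%:R * c - p * d%:R + d%:R * (d%:R * q).
  transitivity
    (\sum_(i < d) \sum_(j < d) ((i == j)%:R * c + - p * J i j ^+ 2 + q)).
    apply: eq_bigr => i _; apply: eq_bigr => j _.
    rewrite /covmap !(mulmxDr, mulmxDl) mul_mx_scalar.
    rewrite -!scalemxAr -!scalemxAl JHJ !mulmxA JHJ mul1mx.
    rewrite -(mulmxA _^T _ J) JHJ mulmx1 trmx_delta.
    rewrite mxE [X in X + _]mxE [X in _ + X + _]mxE.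
    rewrite mulmx_deltaE JHE (Jba i j) trd !mxE !eqxx eq_sym.
    by case: eqVneq => [_|_] /=; ring.
  under eq_bigr => i _ do rewrite !big_split /= -mulr_sumr sumd.
  by rewrite !big_split /= -!mulr_sumr !sumd sum_diag sumJ; ring.
by ring.
Qed.

(** The weights [alpha] and [beta] belong to the identity and to the boundary map, [gamma] and
    [delta] to their images under the exchange of p and q. *)
Lemma covmap_decomposable (C : numClosedFieldType) (d : nat) (J : 'M[C]_d)
    (alpha beta gamma delta : C) :
  (0 < d)%N -> real_symplectic J ->
  0 <= alpha -> 0 <= beta -> 0 <= gamma -> 0 <= delta ->
  decomposable (covmap J (d%:R * (beta + delta))
    (alpha - 2 * beta - d%:R * delta) (gamma - d%:R * beta - 2 * delta)).
Proof.
move=> d_gt0 Jsymp a_ge0 b_ge0 g_ge0 e_ge0.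
have cp1 : completely_positive (covmap J 0 1 0).
  apply: (@completely_positive_kraus _ _ _ 1 unit (fun=> 1%:M)) => // Z.
  rewrite big_const card_unit /= addr0 trmx1 map_mx1 mulmx1 mul1mx /=.
  by rewrite /covmap mul0r raddf0 add0r scale0r addr0.
have cp (a b : C) : 0 <= a -> 0 <= b ->
    completely_positive (covmap J (d%:R * b) (a - 2 * b) (- (d%:R * b))).
  move=> a0 b0; apply: (completely_positive_comb b0 a0
    (covmap_cp_boundary d_gt0 Jsymp) cp1) => Z /=.
  rewrite /covmap; move: (J *m _ *m _) (\tr Z) => Y u.
  by apply/matrixP => i j; rewrite !mxE; ring.
exists (covmap J (d%:R * beta) (alpha - 2 * beta) (- (d%:R * beta))).
exists (covmap J (d%:R * delta) (- (d%:R * delta)) (gamma - 2 * delta)).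
split=> [||Z]; first exact: cp.
  apply: (completely_positive_conj (cp gamma delta g_ge0 e_ge0)) => Z /=.
  exact: covmap_swap.
rewrite /= /covmap; move: (J *m _ *m _) (\tr Z) => Y u.
by apply/matrixP => i j; rewrite !mxE; ring.
Qed.

Lemma covmap_decomposable_ge0 (C : numClosedFieldType) (d : nat) (J : 'M[C]_d)
    (c p q : C) :
  (0 < d)%N -> real_symplectic J -> decomposable (covmap J c p q) ->
  0 <= (d%:R + 2) * c + d%:R * (p + q).
Proof.
move=> d_gt0 Jsymp [L1 [L2 [cp1 cocp2 LE]]].
have : 0 <= sym_functional J (covmap J c p q).
  rewrite (sym_functionalD J LE) addr_ge0 //.
    exact: sym_functional_cp.
  exact: sym_functional_cocp.
by rewrite sym_functional_covmap // pmulr_rge0 // ltr0n.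
Qed.

(** The quantity is the k-th diagonal entry of the image of the projector E_ii. *)
Lemma covmap_positive_delta_ge0 (C : numClosedFieldType) (d : nat)
    (J : 'M[C]_d) (c p q : C) (i k : 'I_d) :
  real_symplectic J -> positive_map (covmap J c p q) ->
  0 <= c + p * (k == i)%:R + q * J k i ^+ 2.
Proof.
case=> JT JH JJ Lpos.
have Eii : psdmx (delta_mx i i : 'M[C]_d).
  have := psdmx_gram (delta_mx i (0 : 'I_1) : 'cV[C]_d).
  by rewrite trmx_delta map_delta_mx mul_delta_mx.
have := psdmx_diag_ge0 k (Lpos _ Eii); congr (0 <= _).
rewrite /= /covmap trmx_delta mxE [X in X + _]mxE [X in _ + X]mxE mulmx_deltaE.
have -> : (J^t* : 'M_d) i k = J k i by rewrite JH -JT mxE.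
rewrite /mxtrace (bigD1 i) //= big1 => [|j /negPf ji].
  by rewrite !mxE !eqxx !andbb expr2 addr0 mulr1.
by rewrite mxE ji.
Qed.

(** * The maps [Lpq] *)

Lemma Omega_real_symplectic (C : numClosedFieldType) (m : nat) :
  real_symplectic (Omega C (m + m)).
Proof.
have OT : (Omega C (m + m))^T = - Omega C (m + m).
  by apply/matrixP => i j; rewrite !mxE opprB.
split=> //.
  rewrite OT; apply/matrixP => i j; rewrite !mxE rmorphN rmorphB /=.
  by rewrite !conjC_nat.
rewrite Omega_block mulmx_block !mul0mx !mulmx0 !add0r !addr0 mul1mx mulmx1.
by rewrite scalar_mx_block opp_block_mx !oppr0.
Qed.

Lemma LpqE (R : realType) (d : nat) (p q : R) :
  Lpq p q =1 covmap (Omega R[i] d) ((1 - p - q) / d%:R)%:C p%:C q%:C.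
Proof.
move=> Z; rewrite /Lpq /covmap scalemx1 fmorph_div rmorph_nat /=.
by rewrite mulrA mulrAC.
Qed.

Lemma Lpq_positive (R : realType) (m : nat) (p q : R)
    (c := (1 - p - q) / (m + m)%:R) :
  (1 < m)%N ->
  positive_map (@Lpq R (m + m) p q) <-> [/\ 0 <= c, 0 <= c + p & 0 <= c + q].
Proof.
move=> m_gt1; have Osymp := @Omega_real_symplectic R[i] m.
have m_gt0 : (0 < m)%N by exact: ltnW.
split=> [Lpos|[c_ge0 cp_ge0 cq_ge0]]; last first.
  apply: (@eq_positive_map _ _ _ (covmap (Omega R[i] (m + m)) c%:C p%:C q%:C)).
    by move=> Z; rewrite /= LpqE.
  apply: covmap_positive; rewrite -?rmorphD ?ler0c ?complex_real ?eqxx //.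
have := eq_positive_map (L' := covmap _ _ _ _) (@LpqE R (m + m) p q) Lpos.
move=> {}Lpos.
have lt0 : (0 < m + m)%N by rewrite addn_gt0 m_gt0.
have lt1 : (1 < m + m)%N by rewrite (leq_trans m_gt1) // leq_addr.
have ltm : (m < m + m)%N by rewrite -{1}[m]addn0 ltn_add2l.
have half : (m + m)./2 = m by rewrite addnn doubleK.
have H := covmap_positive_delta_ge0 (Ordinal lt0) _ Osymp Lpos.
(* With i = 0, the index 0 gives c + p, its symplectic partner m gives c + q, and 1 gives c. The
   index 1 differs from both because m > 1, which is where d >= 4 enters. *)
have := (H (Ordinal lt0), H (Ordinal ltm), H (Ordinal lt1)).
rewrite !mxE -!val_eqE /= half add0n !eqxx (gtn_eqF m_gt0) !(ltn_eqF m_gt0).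
rewrite (ltn_eqF lt0) (ltn_eqF m_gt1) subrr sub0r sqrrN expr1n expr0n /=.
by rewrite !(mulr0, mulr1, addr0) -!rmorphD !ler0c => -[[]].
Qed.

Lemma decomposable_Lpq_ge0 (R : realType) (m : nat) (p q : R)
    (c := (1 - p - q) / (m + m)%:R) :
  (1 < m)%N ->
  decomposable (@Lpq R (m + m) p q) ->
  0 <= ((m + m)%:R + 2) * c + (m + m)%:R * (p + q).
Proof.
move=> m_gt1 Ldec; have Osymp := @Omega_real_symplectic R[i] m.
have lt0 : (0 < m + m)%N by rewrite addn_gt0 ltnW.
have := eq_decomposable (L' := covmap _ _ _ _) (@LpqE R (m + m) p q) Ldec.
move/(covmap_decomposable_ge0 lt0 Osymp).
by rewrite -(rmorph_nat (real_complex R)) -[2](rmorph_nat (real_complex R) 2)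
  -!(rmorphD, rmorphM) ler0c.
Qed.

(* With [e = c / d], the coefficients of the decomposition are [beta = e] and
   [delta = 0] when [p + 2 e >= 0], and otherwise the ones making [alpha]
   vanish. *)
Lemma decomposable_Lpq (R : realType) (m : nat) (p q : R)
    (c := (1 - p - q) / (m + m)%:R) :
  (1 < m)%N -> 0 <= c -> 0 <= c + p -> 0 <= c + q ->
  0 <= ((m + m)%:R + 2) * c + (m + m)%:R * (p + q) ->
  decomposable (@Lpq R (m + m) p q).
Proof.
move=> m_gt1 c_ge0 cp_ge0 cq_ge0; have Osymp := @Omega_real_symplectic R[i] m.
have lt0 : (0 < m + m)%N by rewrite addn_gt0 ltnW.
set D : R := (m + m)%:R => cpq_ge0.
have D_ge4 : 4 <= D by rewrite ler_nat -[4%N]/(2 + 2)%N leq_add.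
have D_gt0 : 0 < D by lra.
suff [a [b [g [e [[a0 b0 g0 e0] cE pE qE]]]]] : exists a b g e : R,
    [/\ [/\ 0 <= a, 0 <= b, 0 <= g & 0 <= e], c = D * (b + e),
        p = a - 2 * b - D * e & q = g - D * b - 2 * e].
  have := @covmap_decomposable R[i] _ _ a%:C b%:C g%:C e%:C lt0 Osymp.
  rewrite !ler0c => /(_ a0 b0 g0 e0); apply: eq_decomposable => Z.
  rewrite [RHS]LpqE -/c cE pE qE /=.
  congr (covmap _ _ _ _ Z);
    by rewrite ?(rmorphB, rmorphD, rmorphM, rmorph_nat) /= ?rmorph_nat.
pose e := c / D; have cE : c = D * e by rewrite /e mulrC divfK ?gt_eqF.
clearbody c e; rewrite {}cE in c_ge0 cp_ge0 cq_ge0 cpq_ge0 *.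
have e_ge0 : 0 <= e by rewrite -(pmulr_rge0 _ D_gt0).
have [pe_ge0|pe_lt0] := lerP 0 (p + 2 * e).
  exists (p + 2 * e), e, (q + D * e), 0.
  by split; [split; lra | ring | ring | ring].
pose b := (p + D * e) / (D - 2).
have D2_gt0 : 0 < D - 2 by lra.
have bE : (D - 2) * b = p + D * e by rewrite /b mulrC divfK ?gt_eqF.
have b_ge0 : 0 <= b by rewrite divr_ge0 //; lra.
(* After clearing D - 2 this reads p + 2 e <= 0, the present case; it makes delta = e - b
   nonnegative. *)
have be : b <= e by rewrite /b ler_pdivrMr //; lra.
(* This is gamma: its sign is the extra inequality divided by D. *)
have cpq' : 0 <= p + q + (D + 2) * e.
  rewrite -(pmulr_rge0 _ D_gt0); move: cpq_ge0; congr (0 <= _); ring.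
exists 0, b, (p + q + (D + 2) * e), (e - b).
split; [split; lra | ring | |].
  have -> : 0 - 2 * b - D * (e - b) = (D - 2) * b - D * e by ring.
  by rewrite bE; ring.
have -> : p + q + (D + 2) * e - D * b - 2 * (e - b)
   = p + q + D * e - (D - 2) * b by ring.
by rewrite bE; ring.
Qed.

Theorem theorem3p3 (R : realType) (d : nat) (d_ge4 : (4 <= d)%N)
    (d_even : ~~ odd d) :
  (forall p q : R,
     (positive_map (@Lpq R d p q) <-> (p, q) \in @P1 R d) /\
     (decomposable (@Lpq R d p q) <-> (p, q) \in @Dset R d)) /\
  (forall p q : R,
     p + q < - ((2 + d%:R) / (d%:R ^+ 2 - d%:R - 2)) ->
     p + (1 - d%:R) * q <= 1 ->
     (1 - d%:R) * p + q <= 1 ->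
     positive_map (@Lpq R d p q) /\ indecomposable (@Lpq R d p q)).
Proof.
have [m dE] : exists m, d = (m + m)%N.
  by exists d./2; rewrite addnn even_halfK.
rewrite {}dE in d_ge4 d_even *.
have m_gt1 : (1 < m)%N.
  by rewrite ltnNge; apply: contraL d_ge4; case: (m) => [|[|]].
have D_ge4 : 4 <= (m + m)%:R :> R by rewrite ler_nat.
(* The denominator factors as (d - 2)(d + 1). *)
have K_gt0 : 0 < (m + m)%:R ^+ 2 - (m + m)%:R - 2 :> R by nra.
have D_gt0 : 0 < (m + m)%:R :> R by lra.
set D : R := (m + m)%:R in D_ge4 K_gt0 D_gt0 *.
have cE p q : D * ((1 - p - q) / D) = 1 - p - q.
  by rewrite mulrC divfK ?gt_eqF.
have posE p q : positive_map (@Lpq R (m + m) p q) <-> (p, q) \in @P1 R (m + m).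
  (* Multiplied by D, the conditions on c, c + p and c + q become the three linear inequalities of
     [P1]. *)
  rewrite Lpq_positive // inE -/D -(pmulr_rge0 _ D_gt0).
  rewrite -(pmulr_rge0 (_ + p) D_gt0) -(pmulr_rge0 (_ + q) D_gt0).
  rewrite !mulrDr !cE; split=> [[? ? ?]|/and3P[? ? ?]].
    by apply/and3P; split; lra.
  by split; lra.
have boundE p q : (- ((2 + D) / (D ^+ 2 - D - 2)) <= p + q)
    = (0 <= (D + 2) * ((1 - p - q) / D) + D * (p + q)).
  rewrite lerNl ler_pdivlMr // -[RHS](pmulr_rge0 _ D_gt0) -[LHS]subr_ge0.
  congr (0 <= _).
  (* Both sides equal D + 2 + (D^2 - D - 2)(p + q). *)
  transitivity ((D + 2) * (D * ((1 - p - q) / D)) + D ^+ 2 * (p + q)).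
    by rewrite cE; ring.
  by ring.
have decE p q :
    decomposable (@Lpq R (m + m) p q) <-> (p, q) \in @Dset R (m + m).
  rewrite inE -/D boundE; split=> [Ldec|/andP[bound /posE]].
    rewrite decomposable_Lpq_ge0 //=.
    by have /posE := decomposable_positive Ldec; rewrite inE.
  by rewrite Lpq_positive // => -[? ? ?]; apply: decomposable_Lpq.
split=> // p q pq_lt p_le q_le; split.
  apply/posE; rewrite inE p_le q_le !andbT.
  (* The remaining condition p + q <= 1 of [P1] holds since the bound on p + q is at most 0. *)
  apply: le_trans (ltW pq_lt) (le_trans _ ler01); rewrite oppr_le0.
  by apply: divr_ge0; [lra | exact: ltW].
by move=> /decE; rewrite inE leNgt pq_lt.
Qed.
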